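(* Let $h$ be a probability distribution function on $\mathbb{R}$ with compact support, mean $\bar\tau$ and variance $\sigma^2$, let $\hat C$ be a fixed real $2\times 2$ matrix, and let $p_\mu$, $\mu\ge 0$, be defined as in the context. Then $$\left.\frac{\partial p_{\mu}}{\partial\mu}\right|_{\mu=0}=0\quad\text{and}\quad\left.\frac{\partial^{2}p_{\mu}}{\partial\mu^{2}}\right|_{\mu=0}=-\sigma^{2}p_{0},$$ where the derivatives at $\mu=0$ of the function $\mu\mapsto p_\mu$ on $[0,\infty)$ are understood as one-sided derivatives.
   Context: The reference distribution $h:\mathbb{R}\to\mathbb{R}$ is a monotone (nondecreasing) function such that the associated Stieltjes measure $dh$ has compact support and $$\int_{-\infty}^{\infty}dh(\theta)=1,\quad\int_{-\infty}^{\infty}\theta\,dh(\theta)=\bar\tau,\quad\int_{-\infty}^{\infty}(\theta-\bar\tau)^2\,dh(\theta)=\sigma^2 .$$ For $\mu>0$ define $h_\mu(\theta)=h(\bar\tau+(\theta-\bar\tau)/\mu)$ (a distribution with mean $\bar\tau$ and variance $\mu^2\sigma^2$) and $$\alpha_\mu=\int_{-\infty}^{\infty}\cos\theta\,dh_\mu(\theta),\qquad \beta_\mu=\int_{-\infty}^{\infty}\sin\theta\,dh_\mu(\theta).$$ For $\mu=0$ (discrete delay at $\bar\tau$) define $\alpha_0=\cos\bar\tau$, $\beta_0=\sin\bar\tau$. Let $$J=\begin{pmatrix}0&-1\\1&0\end{pmatrix},$$ and for $\mu\ge0$ set $$p_\mu=\alpha_\mu\operatorname{tr}(\hat C)+\beta_\mu\operatorname{tr}(J\hat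 C).$$ (In the paper $\hat C=\Psi^{\top}(0)C\Phi(0)$, where $C\in\mathbb{R}^{n\times n}$ is the structure matrix of the feedback and $\Phi,\Psi$ are the $n\times2$ bases of the center eigenspaces of the linear equation and its adjoint; only the fact that $\hat C$ is a fixed real $2\times2$ matrix matters for the statement.) *)

(* Defs.v *)
From HB Require Import structures.
From mathcomp Require Import all_boot all_order all_algebra.
From mathcomp Require Import all_classical all_reals all_analysis.

Set Implicit Arguments.
Unset Strict Implicit.
Unset Printing Implicit Defensive.
Import Order.TTheory GRing.Theory Num.Theory.
Import numFieldNormedType.Exports.

Local Open Scope classical_set_scope.
Local Open Scope ring_scope.

(* The library attaches a Stieltjes measure to right-continuous nondecreasing
   functions only. For a merely nondecreasing h, the Stieltjes measure dh is the
   one with dh(]a, b]) = h(b+) - h(a+), that is, the measure attached to the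
   right-continuous regularization x |-> h(x+). *)
Section Stieltjes.
Context {R : realType}.

Definition right_lim (h : R -> R) (x : R) : R := lim (h y @[y --> x^'+]).

Lemma right_lim_cvg (h : R -> R) (h_nd : {homo h : x y / x <= y}) (x : R) :
  h y @[y --> x^'+] --> right_lim h x.
Proof.
apply: nondecreasing_at_right_is_cvgr; near=> b.
- by move=> y z _ _; exact: h_nd.
- exists (h x) => _ /= [y + <-]; rewrite in_itv/= => /andP[xy _].
  by apply: h_nd; exact: ltW.
Unshelve. all: by end_near. Qed.

Lemma right_lim_ge (h : R -> R) (h_nd : {homo h : x y / x <= y}) (x : R) :
  h x <= right_lim h x.
Proof.
apply: limr_ge; first exact: right_lim_cvg.
by near=> y; apply: h_nd; near: y; exact: nbhs_right_ge.
Unshelve. all: by end_near. Qed.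

Lemma right_lim_le (h : R -> R) (h_nd : {homo h : x y / x <= y}) (x y : R) :
  x < y -> right_lim h x <= h y.
Proof.
move=> xy; apply: limr_le; first exact: right_lim_cvg.
by near=> z; apply: h_nd; near: z; exact: nbhs_right_le.
Unshelve. all: by end_near. Qed.

Lemma right_lim_nondecreasing (h : R -> R) (h_nd : {homo h : x y / x <= y}) :
  {homo right_lim h : x y / x <= y}.
Proof.
move=> x y; rewrite le_eqVlt => /predU1P[->//|xy].
exact: le_trans (right_lim_le h_nd xy) (right_lim_ge h_nd y).
Qed.

Lemma right_lim_right_continuous (h : R -> R)
  (h_nd : {homo h : x y / x <= y}) : right_continuous (right_lim h).
Proof.
move=> x; apply/cvgrPdist_le => e e0.
have /cvgrPdist_le/(_ _ e0) := right_lim_cvg h_nd (x := x).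
move=> [d /= d0 hd]; exists (d / 2) => /=; first by rewrite divr_gt0.
move=> y /= yd xy; have xz : x < x + d / 2 by rewrite ltrDl divr_gt0.
have yz : y < x + d / 2.
  by move: yd; rewrite distrC gtr0_norm ?subr_gt0// ltrBlDl.
have xly := right_lim_nondecreasing h_nd (ltW xy).
have ylz := right_lim_le h_nd yz.
have /hd /= := xz; rewrite opprD addNKr normrN gtr0_norm ?divr_gt0//.
rewrite ltr_pdivrMr// ltr_pMr// ltr1n => /(_ isT).
rewrite !(distrC (right_lim h x)) !ger0_norm ?subr_ge0//.
  by apply: le_trans; rewrite lerD2r.
exact: le_trans ylz.
Qed.

Definition regularization (h : R -> R) (h_nd : {homo h : x y / x <= y}) :
    cumulative R R :=
  HB.pack (right_lim h)
    (isCumulative.Build R _ R (right_lim h)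
       (right_lim_nondecreasing h_nd) (right_lim_right_continuous h_nd)).

Definition stieltjes (h : R -> R) (h_nd : {homo h : x y / x <= y}) :
    {measure set (measurableTypeR R) -> \bar R} :=
  lebesgue_stieltjes_measure (regularization h_nd).

Definition support_of (m : {measure set (measurableTypeR R) -> \bar R}) :
    set R :=
  [set x | forall e : R, 0 < e -> (0 < m (ball x e))%E].

End Stieltjes.

Section OneSidedDerivative.
Context {R : realType}.

(* Derivatives relative to a domain D: at an interior point of D they are the
   usual ones, and for D = `[0, +oo[ at 0 they are right derivatives. *)
Definition diff_quotient (f : R -> R) (x : R) (y : R) : R := (f y - f x) / (y - x).

Definition derivable_within (D : set R) (f : R -> R) (x : R) : Prop :=
  cvg (diff_quotient f x y @[y --> within D x^']).

Definition derive_within (D : set R) (f : R -> R) (x : R) : R :=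
  lim (diff_quotient f x y @[y --> within D x^']).

End OneSidedDerivative.

Section DelayDistribution.
Context {R : realType}.

Definition dilate (h : R -> R) (tau mu : R) : R -> R :=
  fun theta => h (tau + (theta - tau) / mu).

Lemma dilate_nondecreasing (h : R -> R) (h_nd : {homo h : x y / x <= y})
    (tau mu : R) (mu_gt0 : 0 < mu) :
  {homo dilate h tau mu : x y / x <= y}.
Proof.
by move=> x y xy; apply: h_nd; rewrite lerD2l ler_pM2r ?invr_gt0// lerD2r.
Qed.

(* The second branch is only meant for mu = 0. *)
Definition alpha (h : R -> R) (h_nd : {homo h : x y / x <= y})
    (tau mu : R) : R :=
  match pselect (0 < mu) with
  | left mu_gt0 =>
      \int[stieltjes (dilate_nondecreasing h_nd tau mu_gt0)]_theta cos theta
  | right _ => cos tau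
  end.

Definition beta (h : R -> R) (h_nd : {homo h : x y / x <= y})
    (tau mu : R) : R :=
  match pselect (0 < mu) with
  | left mu_gt0 =>
      \int[stieltjes (dilate_nondecreasing h_nd tau mu_gt0)]_theta sin theta
  | right _ => sin tau
  end.

Definition J : 'M[R]_2 := block_mx (0 : 'M[R]_1) (- 1) 1 (0 : 'M[R]_1).

Definition p (h : R -> R) (h_nd : {homo h : x y / x <= y})
    (tau : R) (Chat : 'M[R]_2) (mu : R) : R :=
  alpha h_nd tau mu * \tr Chat + beta h_nd tau mu * \tr (J *m Chat).

End DelayDistribution.

(* Main.v *)
(* Since dh_mu is the image of dh under theta |-> tau + mu (theta - tau), one has
   p_mu = \int (a cos + b sin)(tau + mu (theta - tau)) dh(theta) for every
   mu >= 0, mu = 0 included because dh has mass 1. Differentiating twice under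
   the integral sign, which is licit because the second moment is finite, gives
   the first centred moment (zero) and minus the variance as factors at mu = 0. *)
Require Import Defs.
From HB Require Import structures.
From mathcomp Require Import all_boot all_order all_algebra.
From mathcomp Require Import all_classical all_reals all_analysis.
From mathcomp Require Import measurable_realfun.

Import Order.TTheory GRing.Theory Num.Theory.
Import numFieldNormedType.Exports.

Local Open Scope classical_set_scope.
Local Open Scope ring_scope.

(** * One-sided derivatives on the closed half-line *)

Section WithinDerivative.
Context {R : realType}.

(** Every right neighbourhood of a point [x >= 0] meets the half-line away from [x]. Properness is
    what makes the limit unique, so that convergence determines the value of [derive_within]. *)
Lemma within_itvcy_dnbhs_proper (x : R) :
  0 <= x -> ProperFilter (within `[0, +oo[ x^').
Proof.
move=> x0; apply: Build_ProperFilter => hP.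
suff : x^'+ set0 by exact: filter_not_empty.
have {}hP : nbhs x [set y | y != x -> `[0, +oo[%classic y -> False] := hP.
rewrite /at_right/within/=; apply: filterS hP => y /= yE xy.
apply: yE; first by rewrite gt_eqF.
by rewrite in_itv/= andbT (le_trans x0)// ltW.
Qed.

(** [is_derive] speaks of increments tending to 0, [diff_quotient] of points tending to [x]; a
    sequence [u] of such points is turned into the increments [u n - x]. *)
Lemma cvg_diff_quotient (F : R -> R) (x dF : R) :
  is_derive x 1 F dF -> diff_quotient F x y @[y --> x^'] --> dF.
Proof.
move=> [+ FdF]; rewrite /derivable => /cvg_ex[l Fl].
have {FdF} ldF : l = dF by rewrite -FdF; apply/esym/cvg_lim.
rewrite {}ldF in Fl.
apply/cvgr_dnbhsP => u [ux cu].
have : (forall n, u n - x != 0) /\ u n - x @[n --> \oo] --> 0.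
  by split=> [n|]; [rewrite subr_eq0|exact/subr_cvg0].
move/((cvgr_dnbhsP _ _ _).1 Fl); apply: cvg_trans.
apply: near_eq_cvg; apply: nearW => n.
by rewrite /diff_quotient /= scaler1 subrK /GRing.scale/= mulrC.
Qed.

Lemma cvg_diff_quotient_within (D : set R) (f F : R -> R) (x dF : R) :
  D x -> {in D, f =1 F} -> is_derive x 1 F dF ->
  diff_quotient f x y @[y --> within D x^'] --> dF.
Proof.
move=> Dx fF /cvg_diff_quotient FdF.
have := @cvg_within_filter _ _ _ _ (@dnbhs_filter _ x) _ D FdF.
apply: cvg_trans.
apply: fmap_within_eq => y Dy.
by rewrite /diff_quotient !fF// inE.
Qed.

(** This reduces one-sided derivatives to ordinary ones: it suffices to extend [f] from the
    half-line to a function [F] differentiable at [x] on both sides. *)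
Lemma derive_within_itvcy (f F : R -> R) (x dF : R) :
  0 <= x -> {in `[0, +oo[%classic, f =1 F} -> is_derive x 1 F dF ->
  derivable_within `[0, +oo[ f x /\ derive_within `[0, +oo[ f x = dF.
Proof.
move=> x0 fF FdF; have Dx : `[0, +oo[%classic x by rewrite /= in_itv/= x0.
have fdF := cvg_diff_quotient_within _ _ _ _ _ Dx fF FdF.
split; first by apply/cvg_ex; exists dF.
have := within_itvcy_dnbhs_proper _ x0.
by move=> ?; exact: cvg_lim fdF.
Qed.

End WithinDerivative.

(** * Trigonometric integrands and differentiation under the integral sign *)

Section Trig.
Context {R : realType}.
Implicit Types a b x : R.

(** A family closed under differentiation, which sends [(a, b)] to [(b, - a)]; a single lemma on
    integrals thus serves for both derivatives. *)
Definition trig a b x := cos x * a + sin x * b.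

Lemma is_derive_trig a b x : is_derive x 1 (trig a b) (trig b (- a) x).
Proof.
rewrite /trig; apply: is_derive_eq.
by rewrite !scaler0 !add0r addrC; congr (_ + _); rewrite [LHS]mulrC // mulrN mulNr.
Qed.

Lemma normr_trig_le a b x : `|trig a b x| <= `|a| + `|b|.
Proof.
rewrite /trig (le_trans (ler_normD _ _))// !normrM lerD// ler_piMl//.
  by rewrite ler_norml cos_geN1 cos_le1.
by rewrite ler_norml sin_geN1 sin_le1.
Qed.

Lemma measurable_trig a b : measurable_fun [set: R] (trig a b).
Proof.
apply: continuous_measurable_fun => x.
by apply: differentiable_continuous;
apply/derivable1_diffP; have [] := is_derive_trig a b x.
Qed.

Context d (Y : measurableType d) (m : {measure set Y -> \bar R}).

Lemma integrable_mul_trig (W T : Y -> R) a b :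
  m.-integrable setT (EFin \o W) -> measurable_fun setT T ->
  m.-integrable setT (fun y => (W y * trig a b (T y))%:E).
Proof.
move=> iW mT; have mW := measurable_int _ iW.
apply: (le_integrable measurableT _ _ (integrableZl measurableT (`|a| + `|b|) iW)).
  apply/measurable_EFinP; apply: measurable_funM; first exact/measurable_EFinP.
  exact: (measurableT_comp (measurable_trig a b)).
move=> y _ /=; rewrite lee_fin normrM mulrC normrM.
by rewrite ler_wpM2r// (le_trans (normr_trig_le _ _ _))// ler_norm.
Qed.

(** Dominated differentiation: the partial derivative in the parameter is bounded by
    [(|a| + |b|) |W X|], whatever the parameter. The weight [W] allows iteration, since each
    derivative multiplies it by [X]. *)
Lemma is_derive_integral_trig (W X : Y -> R) (t a b mu : R) :
  measurable_fun setT X ->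
  m.-integrable setT (EFin \o W) ->
  m.-integrable setT (fun y => (W y * X y)%:E) ->
  is_derive mu 1 (fun mu => \int[m]_y (W y * trig a b (t + mu * X y)))
    (\int[m]_y (W y * X y * trig b (- a) (t + mu * X y))).
Proof.
move=> mX iW iWX.
pose f (s : R) y := W y * trig a b (t + s * X y).
have df (s : R) (y : Y) : is_derive s 1 (f ^~ y) (W y * X y * trig b (- a) (t + s * X y)).
  have dl : is_derive s 1 (fun s : R => t + s * X y) (X y).
    by apply: is_derive_eq; rewrite scaler0 !add0r mul1r /GRing.scale/= mulr1.
  have dt := @is_derive1_comp _ (trig a b) (fun s : R => t + s * X y) s _ _
    (is_derive_trig a b _) dl.
  have := @is_deriveZ _ _ _ _ (W y) _ _ _ dt.
  rewrite /GRing.scale/= => dd; apply: (is_derive_eq dd).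
  by rewrite -mulrA [X y * _]mulrC.
have pf (s : R) (y : Y) : partial1of2 f s y = W y * X y * trig b (- a) (t + s * X y).
  by rewrite partial1of2E; have [] := df s y.
have mT (s : R) : measurable_fun setT (fun y => t + s * X y).
  by apply: measurable_funD => //; exact: measurable_funM.
(* The radius 1 is arbitrary, as the bound [G] below is uniform in the parameter. *)
have Imu : `]mu - 1, mu + 1[%classic mu.
  by rewrite /= in_itv/= ltrDl gtrDl ltrN10 ltr01.
pose G y := (`|a| + `|b|) * `|W y * X y|.
have G0 y : 0 <= G y by rewrite mulr_ge0.
have iG : m.-integrable setT (EFin \o G).
  have := integrableZl measurableT (`|a| + `|b|) (integrable_abse iWX).
  by apply: eq_integrable.
have intf (s : R) : `]mu - 1, mu + 1[%classic s -> m.-integrable setT (EFin \o f s).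
  by move=> _; exact: integrable_mul_trig.
have derf (s : R) (y : Y) : `]mu - 1, mu + 1[%classic s -> setT y ->
    derivable (f ^~ y) s 1.
  by move=> _ _; have [] := df s y.
have G_ub (s : R) (y : Y) : `]mu - 1, mu + 1[%classic s -> setT y ->
    `|partial1of2 f s y| <= G y.
  move=> _ _; rewrite pf normrM mulrC /G ler_wpM2r//.
  by rewrite (le_trans (normr_trig_le _ _ _))// normrN addrC.
apply: DeriveDef; first
  exact: (derivable_under_integral measurableT Imu intf derf G0 iG G_ub).
rewrite -derive1E.
rewrite (differentiation_under_integral measurableT Imu intf derf G0 iG G_ub).
by apply: eq_Rintegral => y _; rewrite pf.
Qed.

End Trig.

(** * Effect of a dilation on the Stieltjes measure *)

Section Dilation.
Context {R : realType}.

(** For [mu > 0] the inner affine map is continuous and strictly increasing, so it carries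
    right-hand limits to right-hand limits. *)
Lemma right_lim_dilate (h : R -> R) (h_nd : {homo h : x y / x <= y}) (tau mu x : R) :
  0 < mu -> right_lim (dilate h tau mu) x = right_lim h (tau + (x - tau) / mu).
Proof.
move=> mu_gt0; apply/cvg_lim => //.
pose F z := tau + (z - tau) / mu.
apply: (@increasing_cvg_at_right_comp _ F h x (BRight (x + 1)) (right_lim h (F x))).
- by rewrite bnd_simp ltrDl.
- by move=> y z _ _ yz; rewrite /F ltrD2l ltr_pM2r ?invr_gt0// ltrD2r.
- apply: cvg_at_right_filter; apply: cvgD; first exact: cvg_cst.
  by apply: cvgM; [apply: cvgB; [exact: cvg_id|exact: cvg_cst]|exact: cvg_cst].
- exact: right_lim_cvg.
Qed.

Lemma stieltjes_itvoc (h : R -> R) (h_nd : {homo h : x y / x <= y}) (a b : R) :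
  a <= b -> stieltjes h_nd `]a, b]%classic = (right_lim h b - right_lim h a)%:E.
Proof.
move=> ab; transitivity (wlength (regularization h_nd) `]a, b]%classic).
  by apply: measurable_mu_extE; exact: is_ocitv.
by rewrite wlength_itv_bnd.
Qed.

Lemma measurable_affine (tau mu : R) :
  measurable_fun [set: measurableTypeR R]
    (fun theta : measurableTypeR R => tau + mu * (theta - tau) : measurableTypeR R).
Proof.
apply: measurable_funD => //; apply: measurable_funM => //.
exact: measurable_funB.
Qed.

(** A Lebesgue-Stieltjes measure is determined by its values on half-open intervals, and the
    preimage of such an interval under the affine map is again one, with endpoints given by the
    inverse map. *)
Lemma stieltjes_dilate (h : R -> R) (h_nd : {homo h : x y / x <= y})
    (tau mu : R) (mu_gt0 : 0 < mu) (A : set (measurableTypeR R)) :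
  measurable A ->
  stieltjes (dilate_nondecreasing h_nd tau mu_gt0) A =
  pushforward (stieltjes h_nd) (fun theta => tau + mu * (theta - tau)) A.
Proof.
pose phi (theta : measurableTypeR R) : measurableTypeR R := tau + mu * (theta - tau).
have mphi : measurable_fun setT phi := measurable_affine tau mu.
apply: (@lebesgue_stieltjes_measure_unique _ _ (pushforward (stieltjes h_nd) phi)).
move=> X [[a b] _ <-]/=.
(* When [b < a] the interval is empty and both measures vanish. *)
have [ab|ba] := leP a b; last first.
  by rewrite set_itv_ge ?measure0// bnd_simp -leNgt ltW.
rewrite [LHS]stieltjes_itvoc// !right_lim_dilate//.
rewrite /pushforward.
have -> : phi @^-1` `]a, b] = `]tau + (a - tau) / mu, tau + (b - tau) / mu]%classic.
  apply/seteqP; split => x; rewrite /= !in_itv/= /phi -ltrBlDl -[x <= _]lerBlDl;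
    by rewrite -[_ < x]ltrBrDl -[_ <= b]lerBrDl ltr_pdivrMr// ler_pdivlMr//
      ![_ * mu]mulrC.
rewrite stieltjes_itvoc//.
by rewrite lerD2l ler_pM2r ?invr_gt0// lerD2r.
Qed.

Lemma integral_stieltjes_dilate (h : R -> R) (h_nd : {homo h : x y / x <= y})
    (tau mu : R) (mu_gt0 : 0 < mu) (g : R -> R) :
  measurable_fun [set: R] g ->
  (stieltjes h_nd).-integrable setT (fun theta => (g (tau + mu * (theta - tau)))%:E) ->
  \int[stieltjes (dilate_nondecreasing h_nd tau mu_gt0)]_theta g theta =
  \int[stieltjes h_nd]_theta g (tau + mu * (theta - tau)).
Proof.
move=> mg ig; rewrite /Rintegral.
pose phi (theta : measurableTypeR R) : measurableTypeR R := tau + mu * (theta - tau).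
have mphi : measurable_fun setT phi := measurable_affine tau mu.
rewrite (@eq_measure_integral _ _ _ setT (pushforward (stieltjes h_nd) phi)); last first.
  by move=> A mA _; exact: stieltjes_dilate.
rewrite (integral_pushforward mphi)//.
exact/measurable_EFinP.
Qed.

End Dilation.

(** * Moments of the delay distribution and the derivatives at zero *)

Theorem proposition2 (R : realType) (h : R -> R)
    (h_nd : {homo h : x y / x <= y}) (tau sigma : R) (Chat : 'M[R]_2)
    (h_supp : compact (support_of (stieltjes h_nd)))
    (h_mass : (\int[stieltjes h_nd]_theta 1 = 1)%E)
    (h_mean : (\int[stieltjes h_nd]_theta theta%:E = tau%:E)%E)
    (h_var : (\int[stieltjes h_nd]_theta ((theta - tau) ^+ 2)%:E
              = (sigma ^+ 2)%:E)%E) :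
  [/\ derivable_within `[0, +oo[ (p h_nd tau Chat) 0,
      derive_within `[0, +oo[ (p h_nd tau Chat) 0 = 0,
      \forall mu \near within `[0, +oo[ (nbhs (0 : R)),
        derivable_within `[0, +oo[ (p h_nd tau Chat) mu,
      derivable_within `[0, +oo[
        (derive_within `[0, +oo[ (p h_nd tau Chat)) 0 &
      derive_within `[0, +oo[ (derive_within `[0, +oo[ (p h_nd tau Chat)) 0
        = - sigma ^+ 2 * p h_nd tau Chat 0].
Proof.
set m := stieltjes h_nd in h_supp h_mass h_mean h_var *.
set a := \tr Chat; set b := \tr (J *m Chat).
pose X (theta : measurableTypeR R) : R := theta - tau.
have mX : measurable_fun setT X by exact: measurable_funB.
have i1 : m.-integrable setT (EFin \o cst 1).
  apply/integrableP; split; first exact/measurable_EFinP.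
  by under eq_integral do rewrite /= normr1; rewrite h_mass ltry.
have iX2 : m.-integrable setT (fun y => (X y * X y)%:E).
  apply/integrableP; split.
    by apply/measurable_EFinP; exact: measurable_funM.
  under eq_integral do rewrite gee0_abs ?lee_fin -?expr2 ?sqr_ge0//.
  by rewrite h_var ltry.
(* Domination by [1 + X^2]: either [|X| <= 1], or [|X| >= 1] and then [|X| <= X^2]. *)
have iX : m.-integrable setT (EFin \o X).
  apply: (le_integrable measurableT _ _ (integrableD measurableT i1 iX2)).
    exact/measurable_EFinP.
  move=> y _; rewrite /= lee_fin.
  rewrite [leRHS]ger0_norm ?addr_ge0// -?expr2 ?sqr_ge0//.
  have [X1|/ltW X1] := leP `|X y| 1; first by rewrite (le_trans X1)// lerDl sqr_ge0.
  by rewrite -real_normK ?num_real// (le_trans (ler_peMl _ X1))// -expr2 lerDr.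
have m1 : \int[m]_y (1 : R) = 1 by rewrite /Rintegral h_mass.
have mX0 : \int[m]_y X y = 0.
  (* Splitting the integral of [theta - tau] requires both terms to be integrable; the identity is,
     being [X + tau]. *)
  have itau : m.-integrable setT (EFin \o cst tau).
    have := integrableZl measurableT tau i1; apply: eq_integrable => // y _ /=.
    by rewrite -EFinM mulr1.
  have iid : m.-integrable setT (EFin \o (fun theta : measurableTypeR R => theta : R)).
    have := integrableD measurableT iX itau; apply: eq_integrable => // y _ /=.
    by rewrite -EFinD subrK.
  rewrite /X RintegralB// {1}/Rintegral h_mean/=.
  apply/eqP; rewrite subr_eq0; apply/eqP.
  rewrite -[LHS]mulr1 -m1 -RintegralZl//.
  by apply: eq_Rintegral => y _; rewrite mulr1.
have mX2 : \int[m]_y (X y * X y) = sigma ^+ 2.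
  by rewrite /Rintegral; under eq_integral do rewrite -expr2; rewrite h_var.
(* [F0] and [F1] are defined for negative [mu] too, so [F0] is the two-sided extension of [p]. The
   factor 1 is the weight [W] of [is_derive_integral_trig]. *)
pose F0 mu := \int[m]_y (1 * trig a b (tau + mu * X y)).
pose F1 mu := \int[m]_y (X y * trig b (- a) (tau + mu * X y)).
have F0F1 (mu : R) : is_derive mu 1 F0 (F1 mu).
  have i1X : m.-integrable setT (fun y => (cst 1 y * X y)%:E).
    by move: iX; apply: eq_integrable => // y _; rewrite /= mul1r.
  apply: (is_derive_eq (@is_derive_integral_trig _ _ _ m (cst 1) X tau a b mu mX i1 i1X)).
  by apply: eq_Rintegral => y _; rewrite mul1r.
(* Now the weight is [X]. At 0 the trigonometric factor is the constant [trig (- a) (- b) tau],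
   which leaves the integral of [X^2], that is, the variance. *)
have F1' : is_derive (0 : R) 1 F1 (- sigma ^+ 2 * trig a b tau).
  apply: (is_derive_eq (@is_derive_integral_trig _ _ _ m X X tau b (- a) 0 mX iX iX2)).
  under eq_Rintegral do rewrite mul0r addr0 mulrC.
  by rewrite RintegralZl// mX2 /trig !mulrN -opprD mulNr mulrC mulNr.
have pF : {in `[0, +oo[%classic, p h_nd tau Chat =1 F0}.
  move=> x; rewrite inE/= in_itv/= andbT => x0.
  rewrite /p /alpha /beta -/a -/b; case: pselect => [x_gt0|x_le0]; last first.
    (* On the half-line the default branch of [alpha] and [beta] is reached only at 0, where total
       mass 1 gives the discrete-delay value. *)
    have -> : x = 0 by apply/eqP; rewrite eq_le x0 andbT leNgt; apply/negP.
    rewrite /F0; under eq_Rintegral do rewrite mul0r addr0 mulrC.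
    by rewrite RintegralZl// m1 mulr1.
  have mT : measurable_fun setT (fun y => tau + x * X y).
    by apply: measurable_funD => //; exact: measurable_funM.
  (* Cosine and sine are [trig 1 0] and [trig 0 1]. *)
  have icos : m.-integrable setT (fun y => (cos (tau + x * X y))%:E).
    have := integrable_mul_trig _ _ m (cst 1) _ 1 0 i1 mT.
    by apply: eq_integrable => // y _; rewrite /= /trig mulr1 mulr0 addr0 mul1r.
  have isin : m.-integrable setT (fun y => (sin (tau + x * X y))%:E).
    have := integrable_mul_trig _ _ m (cst 1) _ 0 1 i1 mT.
    by apply: eq_integrable => // y _; rewrite /= /trig mulr1 mulr0 add0r mul1r.
  have mcos := continuous_measurable_fun (@continuous_cos R).
  have msin := continuous_measurable_fun (@continuous_sin R).
  rewrite !integral_stieltjes_dilate//.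
  rewrite -!RintegralZr// -RintegralD//.
  - by apply: eq_Rintegral => y _; rewrite mul1r.
  - by have := integrableZr measurableT a icos.
  - by have := integrableZr measurableT b isin.
have p0 : p h_nd tau Chat 0 = trig a b tau.
  by rewrite /p /alpha /beta; case: pselect => // gt00; have := gt00; rewrite ltxx.
(* Having the derivative at every [x >= 0], not only at 0, shows that the derivative function agrees
   with [F1] on the half-line and can be differentiated again by the same lemma. *)
have dp x : 0 <= x -> derivable_within `[0, +oo[ (p h_nd tau Chat) x /\
    derive_within `[0, +oo[ (p h_nd tau Chat) x = F1 x.
  by move=> x0; exact: derive_within_itvcy.
have [d0 dE0] := dp 0 (lexx _).
have [dd0 ddE0] : derivable_within `[0, +oo[
      (derive_within `[0, +oo[ (p h_nd tau Chat)) 0 /\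
    derive_within `[0, +oo[ (derive_within `[0, +oo[ (p h_nd tau Chat)) 0
    = - sigma ^+ 2 * trig a b tau.
  apply: derive_within_itvcy F1' => // x; rewrite inE/= in_itv/= andbT => x0.
  exact: (dp x x0).2.
rewrite p0; split => //.
  (* At 0 the trigonometric factor is constant, and the first centred moment vanishes. *)
  rewrite dE0 /F1; under eq_Rintegral do rewrite mul0r addr0 mulrC.
  by rewrite RintegralZl// mX0 mulr0.
rewrite near_withinE; apply: nearW => x.
by rewrite /= in_itv/= andbT => /dp[].
Qed.
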